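(* Every Tamari lattice satisfies every Gazpacho identity. That is, for every positive integer $\ell$ and every finite sequence $\vec m=(m_1,\dots,m_d)$ of positive integers with $d\ge 2$, the lattice $\mathsf{A}(\ell)$ satisfies the lattice identity $\mathrm{Gzp}(\vec m)$.
   Context: Notation: $[k]=\{1,\dots,k\}$. Tamari lattices: for a positive integer $n$, let $\mathcal{I}_n=\{(i,j)\in[n]\times[n] : i<j\}$. The Tamari lattice $\mathsf{A}(n)$ is the set of all subsets $\boldsymbol{a}\subseteq\mathcal{I}_n$ that are transitive as binary relations and such that $1\le i<j<k\le n$ and $(i,k)\in\boldsymbol{a}$ imply $(i,j)\in\boldsymbol{a}$; it is ordered by inclusion. It is a lattice, with meet given by intersection and join of two elements given by the transitive closure of their union. A lattice satisfies an identity $u\le v$ (for lattice terms $u,v$) if $u(\vec a)\le v(\vec a)$ for every assignment $\vec a$ of elements of the lattice to the variables. Gazpacho identities: let $\vec m=(m_1,\dots,m_d)$ be a finite sequence of positive integers with $d\ge2$. Let $\mathfrak{F}(\vec m)=\prod_{i=1}^d[m_i]$ (elements $\tau$ are regarded as functions with $\tau(i)\in[m_i]$), and let $\mathfrak{S}_d$ be the set of permutations of $[d]$. In the variables $\mathsf a_{i,j}$ and $\mathsf b_i$ ($1\le i\le d$, $1\le j\le m_i$) define the lattice terms $$\mathsf a_i=\bigvee_{j=1}^{m_i}\mathsf a_{i,j},\qquad \tilde{\mathsf b}_i=\Bigl(\bigvee_{i'=1}^d\mathsf b_{i'}\Bigr)\wedge(\mathsf a_i\vee\mathsf b_i)\quad(1\le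 i\le d),$$ $$\mathsf e_{\vec m}=\bigwedge_{i=1}^d(\mathsf a_i\vee\mathsf b_i),\qquad \mathsf e^*_{\vec m}=\Bigl(\bigvee_{i'=1}^d\mathsf b_{i'}\Bigr)\wedge\mathsf e_{\vec m}.$$ For $(\sigma,\tau)\in\mathfrak{S}_d\times\mathfrak{F}(\vec m)$ define, by downward induction on $i\in\{2,\dots,d\}$, writing $\tau\sigma(i)=\tau(\sigma(i))$, $$\mathsf f^{\sigma,\tau}_d=(\mathsf a_{\sigma(d),\tau\sigma(d)}\vee\tilde{\mathsf b}_{\sigma(1)})\wedge(\mathsf a_{\sigma(d)}\vee\mathsf b_{\sigma(d)}),$$ $$\mathsf f^{\sigma,\tau}_i=(\mathsf a_{\sigma(i),\tau\sigma(i)}\vee\tilde{\mathsf b}_{\sigma(1)})\wedge(\mathsf a_{\sigma(i)}\vee\mathsf b_{\sigma(i)})\wedge\bigwedge_{i<j\le d}\bigl(\mathsf a_{\sigma(i),\tau\sigma(i)}\vee\mathsf f^{\sigma,\tau}_j\bigr)\quad(2\le i<d).$$ The Gazpacho identity $\mathrm{Gzp}(\vec m)$ is $$\mathsf e_{\vec m}\le\mathsf e^*_{\vec m}\vee\bigvee\bigl\{\mathsf f^{\sigma,\tau}_2 : (\sigma,\tau)\in\mathfrak{S}_d\times\mathfrak{F}(\vec m)\bigr\}.$$ *)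

(* Defs.v *)
From HB Require Import structures.
From mathcomp Require Import all_boot all_order all_fingroup.

Set Implicit Arguments.
Unset Strict Implicit.
Unset Printing Implicit Defensive.

Import Order.LTheory.

(* Index sets are 0-based throughout: 'I_n = {0, ..., n-1} stands for         *)
(* [n] = {1, ..., n}.                                                         *)

(** * Tamari lattices *)

Section Tamari.
Variable n : nat.
Implicit Types a b : {set 'I_n * 'I_n}.

Definition intervals : {set 'I_n * 'I_n} := [set p : 'I_n * 'I_n | p.1 < p.2].

Definition set_trans a : bool :=
  [forall i, forall j, forall k,
     ((i, j) \in a) && ((j, k) \in a) ==> ((i, k) \in a)].

Definition is_tamari a : bool :=
  [&& a \subset intervals, set_trans a
    & [forall i : 'I_n, forall j : 'I_n, forall k : 'I_n,
         (i < j < k) && ((i, k) \in a) ==> ((i, j) \in a)]].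

Lemma set_transP a :
  reflect (forall i j k, (i, j) \in a -> (j, k) \in a -> (i, k) \in a)
          (set_trans a).
Proof.
apply: (iffP forallP) => [h i j k ij jk | h i].
  by move/forallP/(_ j)/forallP/(_ k)/implyP: (h i); apply; apply/andP.
by apply/forallP=> j; apply/forallP=> k; apply/implyP=> /andP[]; apply: h.
Qed.

Lemma is_tamariP a :
  reflect [/\ a \subset intervals,
              forall i j k, (i, j) \in a -> (j, k) \in a -> (i, k) \in a
            & forall i j k : 'I_n, i < j -> j < k -> (i, k) \in a ->
                (i, j) \in a]
          (is_tamari a).
Proof.
apply: (iffP and3P) => -[sI /set_transP tr h]; split=> //.
  move=> i j k ij jk ik.
  by move/forallP/(_ i)/forallP/(_ j)/forallP/(_ k)/implyP: h; apply; rewrite ij jk.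
apply/forallP=> i; apply/forallP=> j; apply/forallP=> k.
by apply/implyP=> /andP[/andP[ij jk]]; apply: h.
Qed.

Definition tclosure a : {set 'I_n * 'I_n} :=
  \bigcap_(b : {set 'I_n * 'I_n} | (a \subset b) && set_trans b) b.

Lemma sub_tclosure a : a \subset tclosure a.
Proof. by apply/bigcapsP=> b /andP[]. Qed.

Lemma tclosure_trans a : set_trans (tclosure a).
Proof.
apply/set_transP=> i j k /bigcapP ij /bigcapP jk; apply/bigcapP=> b hb.
have /andP[_ /set_transP tb] := hb.
exact: tb (ij b hb) (jk b hb).
Qed.

Lemma tclosure_min a b : a \subset b -> set_trans b -> tclosure a \subset b.
Proof. by move=> ab tb; apply: bigcap_inf; rewrite ab. Qed.

Record tamari := Tamari { tamari_val :> {set 'I_n * 'I_n};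
                          tamari_valP : is_tamari tamari_val }.

HB.instance Definition _ := [isSub for tamari_val].
HB.instance Definition _ := [Finite of tamari by <:].

Implicit Types x y z : tamari.

Definition tamari_le x y := tamari_val x \subset tamari_val y.

Fact tamari_le_refl : reflexive tamari_le.
Proof. by move=> x; apply: subxx. Qed.

Fact tamari_le_anti : antisymmetric tamari_le.
Proof. by move=> x y h; apply: val_inj; apply/eqP; rewrite eqEsubset. Qed.

Fact tamari_le_trans : transitive tamari_le.
Proof. by move=> y x z; apply: subset_trans. Qed.

HB.instance Definition _ := Order.Le_isPOrder.Build (Order.Disp tt tt) tamari
  tamari_le_refl tamari_le_anti tamari_le_trans.

Fact tamari_meet_subproof x y : is_tamari (tamari_val x :&: tamari_val y).
Proof.
have /is_tamariP[xI xt xl] := tamari_valP x.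
have /is_tamariP[_ yt yl] := tamari_valP y.
apply/is_tamariP; split; first exact: subset_trans (subsetIl _ _) xI.
  move=> i j k; rewrite !inE => /andP[? ?] /andP[? ?].
  by rewrite (xt i j k) // (yt i j k).
move=> i j k ij jk; rewrite !inE => /andP[? ?].
by rewrite (xl i j k) // (yl i j k).
Qed.

Fact tamari_join_subproof x y :
  is_tamari (tclosure (tamari_val x :|: tamari_val y)).
Proof.
have /is_tamariP[xI _ xl] := tamari_valP x.
have /is_tamariP[yI _ yl] := tamari_valP y.
set u := _ :|: _; have /set_transP ct := tclosure_trans u.
have cI : tclosure u \subset intervals.
  apply: tclosure_min; first by rewrite subUset xI.
  by apply/set_transP=> i j k; rewrite !inE; apply: ltn_trans.
apply/is_tamariP; split=> //.
pose B := [set p : 'I_n * 'I_n in tclosure u |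
  [forall j : 'I_n, (p.1 < j < p.2) ==> ((p.1, j) \in tclosure u)]].
have BP i k : reflect ((i, k) \in tclosure u /\
    forall j : 'I_n, i < j -> j < k -> (i, j) \in tclosure u) ((i, k) \in B).
  rewrite inE; apply: (iffP andP) => /= -[ik h]; split=> //.
    by move=> j ij jk; move/forallP/(_ j)/implyP: h; apply; rewrite ij.
  by apply/forallP=> j; apply/implyP=> /andP[]; apply: h.
have cB : tclosure u \subset B.
  apply: tclosure_min.
    apply/subsetP=> -[i k] ik; apply/BP; split.
      exact: (subsetP (sub_tclosure u)).
    move=> j ij jk; apply: (subsetP (sub_tclosure u)).
    by move: ik; rewrite !inE => /orP[/(xl _ _ _ ij jk)|/(yl _ _ _ ij jk)] ->;
      rewrite ?orbT.
  apply/set_transP=> i k l /BP[ik hik] /BP[kl hkl]; apply/BP.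
  split=> [|j ij jl]; first exact: ct ik kl.
  case: (ltngtP j k) => [jk|kj|/val_inj->] //; first exact: hik.
  exact: ct ik (hkl j kj jl).
by move=> i j k ij jk /(subsetP cB)/BP[_]; apply.
Qed.

Definition tamari_meet x y := Tamari (tamari_meet_subproof x y).
Definition tamari_join x y := Tamari (tamari_join_subproof x y).

Fact tamari_meetP x y z :
  (x <= tamari_meet y z)%O = (x <= y)%O && (x <= z)%O.
Proof. exact: subsetI. Qed.

Fact tamari_joinP x y z :
  (tamari_join x y <= z)%O = (x <= z)%O && (y <= z)%O.
Proof.
rewrite -[RHS]subUset; apply/idP/idP => h.
  exact: subset_trans (sub_tclosure _) h.
have /is_tamariP[_ /set_transP zt _] := tamari_valP z.
exact: tclosure_min.
Qed.

HB.instance Definition _ :=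
  Order.POrder_MeetJoin_isLattice.Build (Order.Disp tt tt) tamari
    tamari_meetP tamari_joinP.

End Tamari.

(** * Lattice terms and lattice identities *)

Inductive lterm (V : Type) : Type :=
| LVar of V
| LMeet of lterm V & lterm V
| LJoin of lterm V & lterm V.

Fixpoint leval (V : Type) disp (L : latticeType disp) (v : V -> L)
    (t : lterm V) : L :=
  match t with
  | LVar x => v x
  | LMeet t1 t2 => (leval v t1 `&` leval v t2)%O
  | LJoin t1 t2 => (leval v t1 `|` leval v t2)%O
  end.

(* The pair (u, v) stands for the identity u <= v. *)
Definition lidentity (V : Type) : Type := (lterm V * lterm V)%type.

Definition satisfies disp (L : latticeType disp) (V : Type)
    (e : lidentity V) : Prop :=
  forall v : V -> L, (leval v e.1 <= leval v e.2)%O.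

(* Lattice terms have no constants for the empty meet and the empty join, so  *)
(* a finite meet or join starts from a designated first operand.              *)
Definition lmeets_seq (V : Type) (t : lterm V) (s : seq (lterm V)) :=
  foldl (@LMeet V) t s.
Definition ljoins_seq (V : Type) (t : lterm V) (s : seq (lterm V)) :=
  foldl (@LJoin V) t s.

(* For i0 : I, each index i : I contributes F i exactly once. *)
Definition lmeets (V : Type) (I : finType) (i0 : I) (F : I -> lterm V) :=
  lmeets_seq (F i0) [seq F i | i <- enum I & i != i0].
Definition ljoins (V : Type) (I : finType) (i0 : I) (F : I -> lterm V) :=
  ljoins_seq (F i0) [seq F i | i <- enum I & i != i0].

Section FiniteMeetJoin.
Variables (V : Type) (disp : Order.disp_t) (L : latticeType disp) (v : V -> L).
Implicit Types (t : lterm V) (s : seq (lterm V)) (x : L).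

Lemma le_leval_lmeets_seq t s x :
  (x <= leval v (lmeets_seq t s))%O = all (fun u => x <= leval v u)%O (t :: s).
Proof.
elim: s t => [|u s IHs] t /=; first by rewrite andbT.
by rewrite IHs /= lexI andbA.
Qed.

Lemma leval_ljoins_seq_le t s x :
  (leval v (ljoins_seq t s) <= x)%O = all (fun u => leval v u <= x)%O (t :: s).
Proof.
elim: s t => [|u s IHs] t /=; first by rewrite andbT.
by rewrite IHs /= leUx andbA.
Qed.

Lemma le_leval_lmeets (I : finType) (i0 : I) (F : I -> lterm V) x :
  reflect (forall i, x <= leval v (F i))%O (x <= leval v (lmeets i0 F))%O.
Proof.
rewrite le_leval_lmeets_seq /= all_map; apply: (iffP andP).
  move=> [h0 /allP h] i; have [->|ne] := eqVneq i i0; first exact: h0.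
  by apply: (h i); rewrite mem_filter ne mem_enum.
by move=> h; split; [exact: h | apply/allP=> i _; apply: h].
Qed.

Lemma leval_ljoins_le (I : finType) (i0 : I) (F : I -> lterm V) x :
  reflect (forall i, leval v (F i) <= x)%O (leval v (ljoins i0 F) <= x)%O.
Proof.
rewrite leval_ljoins_seq_le /= all_map; apply: (iffP andP).
  move=> [h0 /allP h] i; have [->|ne] := eqVneq i i0; first exact: h0.
  by apply: (h i); rewrite mem_filter ne mem_enum.
by move=> h; split; [exact: h | apply/allP=> i _; apply: h].
Qed.

End FiniteMeetJoin.

(** * Gazpacho identities *)

Section Gazpacho.
Variables (d : nat) (d_gt1 : 1 < d) (m : 'I_d -> nat).
Hypothesis m_gt0 : forall i, 0 < m i.

Inductive gvar : Type :=
| GA (i : 'I_d) (j : 'I_(m i))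
| GB (i : 'I_d).

(* The 1-based indices 1 and 2 of [d]. *)
Definition ix1 : 'I_d := Ordinal (ltnW d_gt1).
Definition ix2 : 'I_d := Ordinal d_gt1.

Notation choice_fun := {dffun forall i : 'I_d, 'I_(m i)}.

Definition gz_aij (i : 'I_d) (j : 'I_(m i)) : lterm gvar := LVar (GA j).
Definition gz_b (i : 'I_d) : lterm gvar := LVar (GB i).

Definition gz_a (i : 'I_d) : lterm gvar :=
  ljoins (Ordinal (m_gt0 i)) (fun j => gz_aij j).

Definition gz_ab (i : 'I_d) : lterm gvar := LJoin (gz_a i) (gz_b i).

Definition gz_btop : lterm gvar := ljoins ix1 gz_b.

Definition gz_btilde (i : 'I_d) : lterm gvar := LMeet gz_btop (gz_ab i).

Definition gz_e : lterm gvar := lmeets ix1 gz_ab.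

Definition gz_estar : lterm gvar := LMeet gz_btop gz_e.

Section F.
Variables (s : 'S_d) (tau : choice_fun).

Definition gz_atau (i : 'I_d) : lterm gvar := gz_aij (tau (s i)).

Definition gz_f0 (i : 'I_d) : lterm gvar :=
  LMeet (LJoin (gz_atau i) (gz_btilde (s ix1))) (gz_ab (s i)).

(* Downward recursion on i, on a fuel k; see gz_fE for the defining equation. *)
Fixpoint gz_f_rec (k : nat) (i : 'I_d) : lterm gvar :=
  if k is k'.+1 then
    lmeets_seq (gz_f0 i)
      [seq LJoin (gz_atau i) (gz_f_rec k' j) | j : 'I_d <- enum 'I_d & i < j]
  else gz_f0 i.

Definition gz_f (i : 'I_d) : lterm gvar := gz_f_rec d i.

Lemma gz_fE (i : 'I_d) :
  gz_f i = lmeets_seq (gz_f0 i)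
             [seq LJoin (gz_atau i) (gz_f j) | j : 'I_d <- enum 'I_d & i < j].
Proof.
have fuel k : forall l (j : 'I_d), d - j.+1 <= k -> d - j.+1 <= l ->
    gz_f_rec k j = gz_f_rec l j.
  have last (j : 'I_d) l : d - j.+1 <= 0 -> gz_f_rec l j = gz_f0 j.
    rewrite leqn0 subn_eq0 => dj; case: l => //= l.
    rewrite (@eq_filter _ _ pred0) ?filter_pred0 // => j'.
    by apply: negbTE; rewrite -leqNgt -ltnS (leq_trans (ltn_ord j')).
  elim: k => [|k IHk] l j hk hl; first by rewrite !last.
  case: l hl => [|l] hl; first by rewrite !last.
  rewrite /=; congr lmeets_seq; apply/eq_in_map=> j'.
  rewrite mem_filter => /andP[jj' _]; congr LJoin.
  have lt : d - j'.+1 < d - j.+1.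
    by apply: ltn_sub2l; [exact: leq_ltn_trans jj' (ltn_ord j') | exact: jj'].
  by apply: IHk; rewrite -ltnS; apply: leq_trans lt _.
rewrite {1}/gz_f (fuel d d.+1) ?leq_subr // (leq_trans (leq_subr _ _)) //.
Qed.

End F.

Definition gz_tau1 : choice_fun := [ffun i => Ordinal (m_gt0 i)].

Definition gz_rhs : lterm gvar :=
  LJoin gz_estar
    (@ljoins gvar ('S_d * choice_fun)%type (1%g, gz_tau1)
       (fun st => gz_f st.1 st.2 ix2)).

Definition Gzp : lidentity gvar := (gz_e, gz_rhs).

End Gazpacho.

(* Main.v *)
Require Import Defs.
From mathcomp Require Import all_boot all_order all_fingroup.

Set Implicit Arguments.
Unset Strict Implicit.
Unset Printing Implicit Defensive.

Import Order.LTheory.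

(* Write J_i for the value of a_i \/ b_i and B for the join of the b_i.  By   *)
(* induction on y, and since the right-hand side is transitive, it suffices,  *)
(* given (x, y) in e, to find q in [x, y) such that (q, y) belongs to the     *)
(* right-hand side.  Take p in [x, y] least such that p = y or (p, y) belongs *)
(* to B /\ J_i0 for some i0.  If p = x, then (x, y) lies in e*.  If x < p,    *)
(* then a subdivision of [x, y] witnessing (x, y) in J_i yields p_i < p with  *)
(* (p_i, y) in J_i and (p_i, p) in b_i or in some a_(i, tau i); minimality of *)
(* p excludes b_i.  Listing i0 first and then the other indices by            *)
(* nondecreasing p_i defines sigma, and a downward induction on k gives       *)
(* (p_(sigma k), y) in f_k, whence (p_(sigma 2), y) in f_2.                   *)

(** The property of Tamari lattices that drives the argument is left truncation: the steps (p_i, p)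
    all end at the same p, so each can be cut at any p_j with p_i < p_j and continued by (p_j, y).
    [tamari_join_step] supplies the steps, [perm_sorting_after] the order sigma, and [gz_f_mem] the
    downward induction. *)

Section Tamari.
Variable n : nat.
Implicit Types (x y z p q : 'I_n) (u v w : tamari n).

Lemma tamari_lt u x y : (x, y) \in val u -> x < y.
Proof.
by have /is_tamariP[/subsetP uI _ _] := valP u; move/uI; rewrite inE.
Qed.

Lemma tamari_trans u x y z :
  (x, y) \in val u -> (y, z) \in val u -> (x, z) \in val u.
Proof. by have /is_tamariP[_ ut _] := valP u; apply: ut. Qed.

Lemma tamari_left u x y z :
  x < y -> y <= z -> (x, z) \in val u -> (x, y) \in val u.
Proof.
have /is_tamariP[_ _ ul] := valP u.
by rewrite [y <= z]leq_eqVlt => xy /orP[/eqP/val_inj-> //|]; apply: ul.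
Qed.

Lemma tamari_leP u v :
  reflect (forall x y, (x, y) \in val u -> (x, y) \in val v) (u <= v)%O.
Proof.
by apply: (iffP subsetP) => [h x y|h [x y]]; apply: h.
Qed.

Lemma leval_meetE V (v : V -> tamari n) t t' x y :
  ((x, y) \in val (leval v (LMeet t t'))) =
    ((x, y) \in val (leval v t)) && ((x, y) \in val (leval v t')).
Proof. exact: in_setI. Qed.

Lemma tamari_join_trans u v x y z :
  (x, y) \in val u -> (y, z) \in val v -> (x, z) \in val (u `|` v)%O.
Proof.
move=> xy yz; apply: (@tamari_trans _ _ y).
  exact: (tamari_leP _ _ (leUl u v)).
exact: (tamari_leP _ _ (leUr v u)).
Qed.

Lemma leval_lmeets_seqE V (v : V -> tamari n) t s x y :
  ((x, y) \in val (leval v (lmeets_seq t s))) =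
    ((x, y) \in val (leval v t)) &&
    all (fun t' => (x, y) \in val (leval v t')) s.
Proof.
elim: s t => [|t' s IHs] t; first by rewrite andbT.
by rewrite /lmeets_seq [foldl _ _ _]/= IHs leval_meetE andbA.
Qed.

(* The pair (q, p) is the step leading to p, possibly truncated at p, in a    *)
(* subdivision of [x, y] witnessing that (x, y) belongs to the join J.        *)
Lemma tamari_join_step (T : finType) (F : T -> tamari n) J x y p :
  (forall t, F t <= J)%O -> (forall w, (forall t, F t <= w)%O -> (J <= w)%O) ->
  (x, y) \in val J -> x < p -> p <= y ->
  exists t q, [/\ x <= q, (q, p) \in val (F t) & (q, y) \in val J].
Proof.
move=> FJ Jmin xyJ xp py.
(* [D] keeps the pairs of [J] that satisfy the claim for all p. It is itself an element of the
   lattice above every [F t], so minimality of [J] forces [J] below it. *)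
pose D := [set r in val J | [forall p : 'I_n, (r.1 < p <= r.2) ==>
  [exists t, exists q : 'I_n,
    [&& r.1 <= q, (q, p) \in val (F t) & (q, r.2) \in val J]]]].
have DP x' y' : reflect ((x', y') \in val J /\ forall p : 'I_n,
    x' < p -> p <= y' -> exists t q,
    [/\ x' <= q, (q, p) \in val (F t) & (q, y') \in val J]) ((x', y') \in D).
  rewrite inE; apply: (iffP andP) => /= -[xyJ' h]; split=> //.
    move=> p' xp' py'; move/forallP/(_ p')/implyP: h; rewrite xp' py'.
    by case/(_ isT)/existsP=> t /existsP[q /and3P[? ? ?]]; exists t, q.
  apply/forallP=> p'; apply/implyP=> /andP[xp' py'].
  have [t [q [? ? ?]]] := h p' xp' py'.
  by apply/existsP; exists t; apply/existsP; exists q; apply/and3P.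
have DT : is_tamari D.
  apply/is_tamariP; split.
  - apply/subsetP=> -[i k] /DP[/tamari_lt ik _]; by rewrite inE.
  - move=> i j k /DP[ij hij] /DP[jk hjk]; apply/DP.
    split=> [|p' ip p'k]; first exact: tamari_trans ij jk.
    have [p'j|jp'] := leqP p' j.
      have [t [q [iq qp qj]]] := hij p' ip p'j.
      by exists t, q; split=> //; apply: tamari_trans qj jk.
    have [t [q [jq qp qk]]] := hjk p' jp' p'k.
    by exists t, q; split=> //; apply: leq_trans (ltnW (tamari_lt ij)) jq.
  - move=> i j k ij jk /DP[ik hik]; apply/DP.
    split=> [|p' ip p'j]; first exact: tamari_left ij (ltnW jk) ik.
    have [t [q [iq qp qk]]] := hik p' ip (leq_trans p'j (ltnW jk)).
    exists t, q; split=> //; apply: tamari_left (ltnW jk) qk.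
    exact: leq_trans (tamari_lt qp) p'j.
have /tamari_leP JD : (J <= Tamari DT)%O.
  apply: Jmin => t; apply/tamari_leP=> i k ik; apply/DP.
  have ikJ := tamari_leP _ _ (FJ t) _ _ ik.
  split=> // p' ip p'k; exists t, i; split=> //; exact: tamari_left ip p'k ik.
by have /DP[_] := JD _ _ xyJ; apply.
Qed.

End Tamari.

(** The permutation reads off the list [i0 :: t], where [t] sorts the other indices by [key]. The
    key of [i0] is unconstrained, whence the condition [0 < i]. *)
Lemma perm_sorting_after d (d_gt0 : 0 < d) (i0 : 'I_d) (key : 'I_d -> nat) :
  exists s : 'S_d, s (Ordinal d_gt0) = i0 /\
    forall i j : 'I_d, 0 < i -> i <= j -> key (s i) <= key (s j).
Proof.
pose r := relpre key leq.
pose t := sort r (filter (predC1 i0) (enum 'I_d)).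
have r_trans : transitive r by move=> ? ? ?; apply: leq_trans.
have tP : perm_eq (i0 :: t) (enum 'I_d).
  rewrite perm_sym (perm_trans (perm_to_rem (mem_enum _ i0))) // perm_cons.
  by rewrite rem_filter ?enum_uniq // perm_sym perm_sort.
have szt : size (i0 :: t) = d by rewrite (perm_size tP) size_enum_ord.
have s_inj : injective (fun k : 'I_d => nth i0 (i0 :: t) k).
  move=> i j /eqP; rewrite nth_uniq ?szt ?(perm_uniq tP) ?enum_uniq //.
  by move/eqP/val_inj.
exists (perm s_inj); split=> [|i j i0' ij]; rewrite !permE //.
case: i j i0' ij => [[|i] //= hi] [[|j] //= hj] _ ij.
have sort_t : sorted r t by apply: sort_sorted => ? ?; apply: leq_total.
have r_refl : reflexive r by move=> ?; apply: leqnn.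
have lt_t k : k.+1 < d -> k \in [pred k | k < size t] by rewrite inE -[X in _ < X]szt.
exact: (sorted_leq_nth r_trans r_refl i0 sort_t i j (lt_t i hi) (lt_t j hj) ij).
Qed.

Section Gazpacho.
Variables (l d : nat) (d_gt1 : 1 < d) (m : 'I_d -> nat).
Hypothesis m_gt0 : forall i, 0 < m i.
Variable v : gvar m -> tamari l.

Local Notation val_of t := (val (leval v t)).
Local Notation btop := (gz_btop d_gt1 m).
Local Notation ab := (gz_ab m_gt0).
Local Notation btilde := (gz_btilde d_gt1 m_gt0).

(** The term [ab i] is treated as a single join indexed by an option type: [None] stands for b_i and
    [Some j] for a_(i, j). *)
Lemma gz_ab_step i (x y p : 'I_l) :
  (x, y) \in val_of (ab i) -> x < p -> p <= y ->
  exists2 q : 'I_l, x <= q /\ (q, y) \in val_of (ab i) &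
    (q, p) \in val (v (GB m i)) \/ exists j, (q, p) \in val (v (@GA d m i j)).
Proof.
pose F (t : option 'I_(m i)) := v (if t is Some j then GA j else GB m i).
have aP := leval_ljoins_le v (Ordinal (m_gt0 i)) (fun j => gz_aij j).
have FJ t : (F t <= leval v (ab i))%O.
  case: t => [j|]; last exact: leUr.
  by apply: le_trans (leUl _ _); apply: (aP _ (le_refl _) j).
have Jmin w : (forall t, F t <= w)%O -> (leval v (ab i) <= w)%O.
  move=> Fw; rewrite leUx (Fw None) andbT.
  by apply/aP=> j; apply: (Fw (Some j)).
move=> xy xp py.
have [[j|] [q [xq qp qy]]] := tamari_join_step FJ Jmin xy xp py; exists q => //.
  by right; exists j.
by left.
Qed.

Lemma gz_b_le_btop i : (v (GB m i) <= leval v btop)%O.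
Proof. exact: (leval_ljoins_le v (ix1 d_gt1) (@gz_b d m) _ (le_refl _) i). Qed.

(** For j > i, either [P (s i) = P (s j)] and the pair already lies in f_j, or the a-step from
    [P (s i)] to p is truncated at [P (s j)] and composed with the pair in f_j. *)
Lemma gz_f_mem (s : 'S_d) (tau : {dffun forall i : 'I_d, 'I_(m i)})
    (P : 'I_d -> 'I_l) (p y : 'I_l) :
  (p = y \/ (p, y) \in val_of (btilde (s (ix1 d_gt1)))) ->
  (forall i, (P i, y) \in val_of (ab i)) ->
  (forall i, (P i, p) \in val (v (GA (tau i)))) ->
  (forall i j : 'I_d, 0 < i -> i <= j -> P (s i) <= P (s j)) ->
  forall i : 'I_d, 0 < i ->
    (P (s i), y) \in val_of (gz_f d_gt1 m_gt0 s tau i).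
Proof.
move=> hp Pab Pp Ps i.
(* Downward induction on i, as strong induction on [d - i]. *)
have [k] := ubnP (d - i); elim: k i => // k IHk i; rewrite ltnS => dik i_gt0.
have aP := tamari_leP _ _ (leUl (v (GA (tau (s i)))) _).
rewrite gz_fE leval_lmeets_seqE leval_meetE Pab andbT.
apply/andP; split.
  case: hp => [<-|py]; first exact: aP.
  exact: tamari_join_trans (Pp _) py.
rewrite all_map; apply/allP=> j; rewrite mem_filter => /andP[ij _] /=.
have hj : (P (s j), y) \in val_of (gz_f d_gt1 m_gt0 s tau j).
  apply: IHk; last exact: leq_trans ij.
  by apply: leq_trans dik; apply: ltn_sub2l ij; apply: ltn_ord.
have := Ps i j i_gt0 (ltnW ij); rewrite leq_eqVlt => /orP[/eqP/val_inj->|Pij].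
  exact: (tamari_leP _ _ (leUr _ _)).
apply: tamari_join_trans hj.
exact: tamari_left Pij (ltnW (tamari_lt (Pp (s j)))) (Pp _).
Qed.

(** The witness q is x if p = x; otherwise it is [P (s ix2)], the least p_i over the indices other
    than i0. *)
Lemma gz_rhs_last_step (x y : 'I_l) :
  (x, y) \in val_of (gz_e d_gt1 m_gt0) ->
  exists2 q : 'I_l, x <= q & (q, y) \in val_of (gz_rhs d_gt1 m_gt0).
Proof.
move=> xye; have xy := tamari_lt xye.
have xyab i : (x, y) \in val_of (ab i).
  exact: (tamari_leP _ _ (le_leval_lmeets v (ix1 d_gt1) ab _ (le_refl _) i)).
pose W := [pred p : 'I_l | (x <= p) &&
  ((p == y) || [exists i, (p, y) \in val_of (btilde i)])].
have Wy : W y by rewrite /= eqxx ltnW.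
have [p /andP[xp Wp] pmin] := arg_minnP (fun p : 'I_l => val p) Wy.
have [px|xltp] := leqP p x.
  have {xp px}px : p = x by apply/val_inj/eqP; rewrite eqn_leq px.
  exists x => //; apply: (tamari_leP _ _ (leUl _ _)).
  rewrite leval_meetE xye andbT.
  move: Wp; rewrite px -val_eqE (ltn_eqF xy) => /existsP[i].
  by rewrite leval_meetE => /andP[].
have [i0 hp] : exists i0, p = y \/ (p, y) \in val_of (btilde i0).
  (* If p = y, any index can serve as i0. *)
  case/orP: Wp => [/eqP->|/existsP[i hi]]; first by exists (ix1 d_gt1); left.
  by exists i; right.
have py : p <= y by case: hp => [->//|/tamari_lt/ltnW].
have /fin_all_exists[P hP] i : exists q : 'I_l, [/\ x <= q,
    (q, y) \in val_of (ab i) & exists j, (q, p) \in val (v (@GA d m i j))].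
  have [q [xq qy] [qb|qa]] := gz_ab_step (xyab i) xltp py; exists q; split=> //.
  (* A step in b_i lies in B; composed with (p, y) in B, or alone if p = y, it puts q < p in [W],
     against the minimality of p. *)
  have qB := tamari_leP _ _ (gz_b_le_btop i) _ _ qb.
  suff /pmin : W q by rewrite /= leqNgt (tamari_lt qb).
  apply/andP; split=> //; apply/orP; right; apply/existsP; exists i.
  rewrite leval_meetE qy andbT.
  case: hp => [<- //|]; rewrite leval_meetE => /andP[pB _].
  exact: tamari_trans qB pB.
have /fin_all_exists[tf tfP] i : exists j, (P i, p) \in val (v (@GA d m i j)).
  by case: (hP i).
pose tau : {dffun forall i : 'I_d, 'I_(m i)} := [ffun i => tf i].
have [s [s1 Ps]] := perm_sorting_after (ltnW d_gt1) i0 (fun i => P i).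
exists (P (s (ix2 d_gt1))); first by case: (hP (s (ix2 d_gt1))).
apply: (tamari_leP _ _ (leUr _ _)).
apply: (tamari_leP _ _ (leval_ljoins_le v _ _ _ (le_refl _) (s, tau))).
apply: (gz_f_mem (p := p)) => //.
- by rewrite /ix1 s1.
- by move=> i; case: (hP i).
- by move=> i; rewrite ffunE.
Qed.

End Gazpacho.

Theorem theorem7p1 (l : nat) (l_gt0 : 0 < l)
  (d : nat) (d_gt1 : 1 < d) (m : 'I_d -> nat) (m_gt0 : forall i, 0 < m i) :
  satisfies (tamari l) (Gzp d_gt1 m_gt0).
Proof.
move=> v; apply/tamari_leP=> x y; have [k] := ubnP (val y).
elim: k y => // k IHk y; rewrite ltnS => yk xye.
(* If x < q, then (x, q) is in e by truncation and q < y, so the induction hypothesis covers (x,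
   q). *)
have [q xq qy] := gz_rhs_last_step xye.
move: xq; rewrite leq_eqVlt => /orP[/eqP/val_inj-> //|xq].
have qlty := tamari_lt qy; apply: tamari_trans qy; apply: IHk.
  exact: leq_trans qlty yk.
exact: tamari_left xq (ltnW qlty) xye.
Qed.
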